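(* For every graph $G$ with pathwidth $\theta$, $$\pi(G)\le 2\theta^2+6\theta+1.$$
   Context: All graphs are simple, finite and undirected. A path is even if its number of vertices is even. Given a vertex colouring $\psi$ of $G$, an even path $v_1,\dots,v_{2t}$ ($t\ge1$) of $G$ (a subgraph, not necessarily induced) is repetitively coloured by $\psi$ if $\psi(v_i)=\psi(v_{t+i})$ for all $i\in\{1,\dots,t\}$. A colouring is nonrepetitive if no path of $G$ is repetitively coloured. The nonrepetitive chromatic number $\pi(G)$ is the minimum integer $k$ such that $G$ has a nonrepetitive colouring with $k$ colours. A path decomposition of $G$ is a sequence $B_1,\dots,B_p$ of subsets of $V(G)$ (bags) such that the endpoints of each edge of $G$ appear together in some bag, and for each vertex $v$ the set $\{x : v\in B_x\}$ is a nonempty set of consecutive indices. Its width is $\max_x |B_x|-1$, and the pathwidth of $G$ is the minimum width of a path decomposition of $G$. *)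

(* Defs.v *)
From mathcomp Require Import all_boot.
From mathcomp Require Import boolp.

Set Implicit Arguments.
Unset Strict Implicit.
Unset Printing Implicit Defensive.

Record sgraph := SGraph {
  vertex :> finType;
  edge : rel vertex;
  edge_sym : symmetric edge;
  edge_irr : irreflexive edge }.

Definition is_path (G : sgraph) (s : seq G) : bool :=
  uniq s && sorted (@edge G) s.

Definition repetitively_coloured (G : sgraph) (C : Type) (psi : G -> C)
    (s : seq G) : Prop :=
  exists t, [/\ 0 < t, size s = t + t &
    forall i, i < t -> onth (map psi s) i = onth (map psi s) (t + i)].

Definition nonrepetitive (G : sgraph) (C : Type) (psi : G -> C) : Prop :=
  forall s : seq G, is_path s -> ~ repetitively_coloured psi s.

Definition nonrepetitively_colourable (G : sgraph) (k : nat) : Prop :=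
  exists psi : G -> 'I_k, nonrepetitive psi.

Lemma nonrepetitively_colourable_card (G : sgraph) :
  nonrepetitively_colourable G #|G|.
Proof.
exists enum_rank => s /andP[uniq_s _] [t [t_gt0 size_s eq_col]].
case: s size_s uniq_s eq_col => [|x s] size_s uniq_s eq_col.
  by case: t t_gt0 size_s {eq_col}.
have lt_t : t < size (x :: s) by rewrite size_s -{1}[t]addn0 ltn_add2l.
have := eq_col 0 t_gt0.
rewrite addn0 [onth _ 0]/= => /esym/(onth_nth (enum_rank x)).
rewrite (nth_map x) // => /enum_rank_inj/eqP.
rewrite -[X in _ == X]/(nth x (x :: s) 0).
by rewrite nth_uniq // -leqn0 leqNgt t_gt0.
Qed.

Lemma ex_nonrepetitively_colourable (G : sgraph) :
  exists k, `[< nonrepetitively_colourable G k >].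
Proof. by exists #|G|; apply/asboolP/nonrepetitively_colourable_card. Qed.

Definition nonrepetitive_chromatic_number (G : sgraph) : nat :=
  ex_minn (ex_nonrepetitively_colourable G).

Definition is_path_decomposition (G : sgraph) (B : seq {set G}) : Prop :=
  [/\ forall u v : G, edge u v ->
        exists2 b : {set G}, b \in B & (u \in b) && (v \in b),
      forall v : G, exists2 x, x < size B & v \in nth set0 B x
    & forall (v : G) (x y z : nat), x <= y <= z -> z < size B ->
        v \in nth set0 B x -> v \in nth set0 B z -> v \in nth set0 B y].

(* The predecessor is truncated: the width is the usual one as soon as some
   bag is nonempty, so it only matters for the graph without vertices, whose
   pathwidth is thereby 0 instead of -1. *)
Definition width (G : sgraph) (B : seq {set G}) : nat :=
  (\max_(b <- B) #|b|).-1.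

Definition has_path_decomposition_of_width (G : sgraph) (w : nat) : Prop :=
  exists2 B : seq {set G}, is_path_decomposition B & width B = w.

Lemma ex_path_decomposition (G : sgraph) :
  exists w, `[< has_path_decomposition_of_width G w >].
Proof.
exists (width [:: [set: G]]); apply/asboolP; exists [:: [set: G]] => //.
split=> [u v _|v|v x y z /andP[_ le_yz]].
- by exists [set: G]; rewrite ?mem_seq1 // !inE.
- by exists 0; rewrite ?inE.
- by rewrite ltnS leqn0 => /eqP z0; move: le_yz; rewrite z0 leqn0 => /eqP->.
Qed.

Definition pathwidth (G : sgraph) : nat := ex_minn (ex_path_decomposition G).

(* Main.v *)
Require Import Defs.
From mathcomp Require Import all_boot.
From mathcomp Require Import zify boolp.

(** A path decomposition whose bags have at most [k + 1] vertices amounts to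
    an interval [[l v, r v]] for each vertex such that adjacent vertices have
    intersecting intervals and no point lies in more than [k + 1] of them.  The
    bound [f k = 2 * k ^ 2 + 6 * k + 1] comes from an induction on [k], for the
    vertices of an arbitrary subset [A], in which one step costs
    [f k.+1 - f k = 4 * k.+2] colours.

    Scan the points from left to right and select a point whenever its bag is
    disjoint from the bag of the last selected point.  The selected bags, called
    layers, are then pairwise disjoint, and each bag that is not selected meets
    the selected bag before it; so the vertices outside the layers have
    bags with one vertex fewer ([separating_layers]) and are coloured by
    induction with fresh colours.

    A vertex of layer [i] receives as colour a label that distinguishes it from
    the other vertices of its layer, together with the [i]-th letter of an
    infinite word on four letters.  Suppose that a path is repetitively
    coloured.  Since the colours tell which vertices lie in a layer, the
    sequence of its vertices in layers is still repetitively coloured; it is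
    nonempty by the induction hypothesis.  Selected bags separate what is on
    their left from what is on their right, so two successive vertices of this
    sequence are in equal or consecutive layers: their layer numbers form a walk
    on the line that may also stand still.

    The word is square-free and any three consecutive letters of it are
    distinct.  For such a word, every repetitively coloured walk of this kind is
    at the same place at some step of its first half and at the corresponding
    step of the second half ([repetitive_lazy_walk]).  The two vertices
    visited there have the same layer and the same label, so they are equal,
    which is absurd in a path.

    The word arises from the Thue-Morse word, which has no overlaps:
    its successive differences form a square-free word on three letters, and a
    fourth letter inserted after every second one makes letters at distance two
    distinct. *)

Set Implicit Arguments.
Unset Strict Implicit.
Unset Printing Implicit Defensive.

(** * A square-free word on four letters *)

(** The parity of the number of ones in the binary expansion of [n]; any fuel
    that is at least [n] suffices. *)
Fixpoint bit_parity (fuel n : nat) : bool :=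
  if fuel is f.+1 then odd n (+) bit_parity f n./2 else false.

Definition thue_morse (n : nat) : bool := bit_parity n n.

Lemma bit_parity_fuel f g n : n <= f -> n <= g -> bit_parity f n = bit_parity g n.
Proof.
have bp0 h : bit_parity h 0 = false by elim: h => //= h ->.
elim: f g n => [|f IHf] [|g] n; rewrite ?leqn0.
- by [].
- by move=> /eqP-> _; rewrite !bp0.
- by move=> _ /eqP->; rewrite !bp0.
by move=> nf ng /=; congr (_ (+) _); apply: IHf; lia.
Qed.

Lemma thue_morse_half n : thue_morse n = odd n (+) thue_morse n./2.
Proof.
case: n => [|n] //; rewrite {1}/thue_morse [LHS]/=; congr (_ (+) _).
by apply: bit_parity_fuel => //=; lia.
Qed.

Lemma thue_morse_double m : thue_morse m.*2 = thue_morse m.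
Proof. by rewrite thue_morse_half odd_double doubleK. Qed.

Lemma thue_morse_doubleS m : thue_morse m.*2.+1 = ~~ thue_morse m.
Proof. by rewrite thue_morse_half /= odd_double uphalf_double. Qed.

Lemma thue_morse_even_neq n : ~~ odd n -> thue_morse n.+1 = ~~ thue_morse n.
Proof.
move=> /even_halfK <-.
by rewrite thue_morse_double thue_morse_doubleS.
Qed.

(** If the period [p] is odd, of two adjacent positions one pair among [i, i+1]
    and [p+i, p+i+1] starts at an even place, where two successive letters
    always differ; so the word alternates along one period, and then the
    letters at both ends of it differ.  If [p] is even,
    the letters at the even places, or at the odd ones, form an overlap of
    period [p / 2]. *)
Lemma thue_morse_overlap_free n p :
  0 < p -> ~ (forall i, i <= p -> thue_morse (n + i) = thue_morse (n + p + i)).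
Proof.
elim/ltn_ind: p n => p IHp n p_gt0 ov.
have [odd_p|even_p] := boolP (odd p).
  have alt i : i <= p -> thue_morse (n + i) = odd i (+) thue_morse n.
    elim: i => [|i IHi] le_ip; first by rewrite addn0.
    have -> : thue_morse (n + i.+1) = ~~ thue_morse (n + i).
      have [odd_ni|even_ni] := boolP (odd (n + i)).
        rewrite ov // (ov i (ltnW le_ip)) addnS thue_morse_even_neq //; lia.
      by rewrite addnS thue_morse_even_neq.
    by rewrite IHi ?(ltnW le_ip) //= addNb.
  have := ov 0 (leq0n p); rewrite !addn0 alt // odd_p.
  by case: (thue_morse n).
have p_half : p = p./2.*2 by rewrite even_halfK.
apply: (IHp p./2 _ n./2); [lia | lia |] => i le_i.
have := ov i.*2; have [odd_n|even_n] := boolP (odd n).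
  have -> : n + i.*2 = (n./2 + i).*2.+1 by lia.
  have -> : n + p + i.*2 = (n./2 + p./2 + i).*2.+1 by lia.
  by rewrite !thue_morse_doubleS => /(_ _)/negb_inj; apply; lia.
have -> : n + i.*2 = (n./2 + i).*2 by lia.
have -> : n + p + i.*2 = (n./2 + p./2 + i).*2 by lia.
by rewrite !thue_morse_double; apply; lia.
Qed.

Definition squarefree (c : nat -> nat) : Prop :=
  forall x p, 0 < p -> ~ (forall j, j < p -> c (x + j) = c (x + p + j)).

(** Palindrome-freeness in its local form: palindromes of length two and
    three would repeat a letter at distance one or two. *)
Definition window_injective (c : nat -> nat) : Prop :=
  forall x y, x <= y + 2 -> y <= x + 2 -> c x = c y -> x = y.

(** The difference of successive letters, shifted by one to be a natural
    number. *)
Definition ternary_word (n : nat) : nat :=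
  1 + thue_morse n.+1 - thue_morse n.

Lemma ternary_word_lt3 n : ternary_word n < 3.
Proof. by rewrite /ternary_word; case: thue_morse; case: thue_morse. Qed.

(** Both halves of a square have the same sum of differences, that is,
    the Thue-Morse word changes by the same amount along both; as its letters are
    0 and 1, this amount is 0, and the square comes from an overlap. *)
Lemma ternary_word_squarefree : squarefree ternary_word.
Proof.
move=> x p p_gt0 sq; apply: (@thue_morse_overlap_free x p p_gt0).
have inc j : j <= p -> thue_morse (x + j) + thue_morse (x + p)
    = thue_morse x + thue_morse (x + p + j) :> nat.
  elim: j => [|j IHj] le_jp; first by rewrite !addn0.
  by have := sq j le_jp; have := IHj (ltnW le_jp); rewrite /ternary_word !addnS; lia.
have := inc p (leqnn p) => incp i /inc.
by move: incp; do 5?case: thue_morse.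
Qed.

Definition quaternary_word (n : nat) : nat :=
  if n %% 3 == 2 then 3 else ternary_word (n %/ 3 * 2 + n %% 3).

Lemma quaternary_word_lt4 n : quaternary_word n < 4.
Proof.
rewrite /quaternary_word; case: ifP => // _.
exact: ltnW (ternary_word_lt3 _).
Qed.

Lemma ternary_word_neqS n : ternary_word n <> ternary_word n.+1.
Proof.
move=> eq_n; apply: (@ternary_word_squarefree n 1) => // -[|//] _.
by rewrite !addn0 addn1.
Qed.

Lemma quaternary_word_window : window_injective quaternary_word.
Proof.
move=> x y; wlog lt_xy : x y / x < y.
  move=> wl xy yx eq_q; case: (ltngtP x y) => [lt_xy|lt_yx|//]; first exact: wl.
  exact/esym/wl.
move=> _ le_yx.
have := ternary_word_lt3; have := ternary_word_neqS.
rewrite /quaternary_word => neq lt3.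
case: ifP => [x2|x2]; case: ifP => y2.
- by move: x2 y2; lia.
- by move=> eq3; have := lt3 (y %/ 3 * 2 + y %% 3); rewrite -eq3.
- by move=> eq3; have := lt3 (x %/ 3 * 2 + x %% 3); rewrite eq3.
have -> : y %/ 3 * 2 + y %% 3 = (x %/ 3 * 2 + x %% 3).+1 by lia.
by move/neq.
Qed.

Lemma quaternary_word_skip n : quaternary_word (n + n./2) = ternary_word n.
Proof.
rewrite /quaternary_word; case: ifP => h; first by move: h; lia.
by congr ternary_word; lia.
Qed.

(** A square of period at least 3 contains the separator 3, which occurs exactly
    at the places congruent to 2 modulo 3, so its period is a multiple of 3;
    without its separators it is a square of the ternary word. *)
Lemma quaternary_word_squarefree : squarefree quaternary_word.
Proof.
move=> x p p_gt0 sq.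
have p_ge3 : 2 < p.
  rewrite ltnNge; apply/negP => le_p2.
  by have := sq 0 p_gt0; rewrite !addn0 => /quaternary_word_window; lia.
have p3 : p %% 3 = 0.
  have := sq (2 - x %% 3); rewrite /quaternary_word.
  have -> : (x + (2 - x %% 3)) %% 3 == 2 by lia.
  case: ifP => [h _|_ h]; first by move: h; lia.
  have /h : 2 - x %% 3 < p by lia.
  by have := ternary_word_lt3
    ((x + p + (2 - x %% 3)) %/ 3 * 2 + (x + p + (2 - x %% 3)) %% 3); lia.
(* The first letter of the ternary word that is found at or after place [x]. *)
pose m' := if x %% 3 == 2 then x %/ 3 * 2 + 2 else x %/ 3 * 2 + x %% 3.
have m'E : m' = if x %% 3 == 2 then x %/ 3 * 2 + 2 else x %/ 3 * 2 + x %% 3 by [].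
apply: (@ternary_word_squarefree m' (p %/ 3 * 2)) => [|j lt_j]; first by lia.
rewrite -!quaternary_word_skip.
have le_x : x <= m' + j + (m' + j)./2 by move: m'E; case: ifP => h; lia.
have := sq (m' + j + (m' + j)./2 - x).
have -> : x + (m' + j + (m' + j)./2 - x) = m' + j + (m' + j)./2 by lia.
have -> : x + p + (m' + j + (m' + j)./2 - x)
  = m' + p %/ 3 * 2 + j + (m' + p %/ 3 * 2 + j)./2 by lia.
by apply; move: m'E; case: ifP => h; lia.
Qed.

(** * Repetitively coloured walks on the line *)

Definition near (x y : nat) : bool := (x <= y.+1) && (y <= x.+1).

Lemma lazy_walk_ivt (w : nat -> nat) n m :
  (forall i, i < n -> near (w i) (w i.+1)) ->
  (w 0 <= m <= w n) || (w n <= m <= w 0) -> exists2 i, i <= n & w i = m.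
Proof.
elim: n => [|n IHn] step hm; first by exists 0 => //; lia.
have [eq_m|neq_m] := eqVneq (w n.+1) m; first by exists n.+1.
have := step n (leqnn _); rewrite /near => near_n.
case: IHn => [i lt_in||i le_in eq_i]; [by apply: step; lia | lia |].
by exists i => //; lia.
Qed.

(** Around a place of the walk, the letters of its two neighbours and its own are
    distinct, so the colour of a move tells its direction.  Hence the colours
    of a walk determine it up to its starting place and the direction of its
    first true move: two walks with the same colours differ by a translation or
    a reflection of the line. *)
Lemma equicoloured_walks (c u v : nat -> nat) n :
  window_injective c ->
  (forall i, i < n -> near (u i) (u i.+1)) ->
  (forall i, i < n -> near (v i) (v i.+1)) ->
  (forall i, i <= n -> c (u i) = c (v i)) ->
  (forall i, i <= n -> v i + u 0 = v 0 + u i) \/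
  (forall i, i <= n -> v i + u i = v 0 + u 0).
Proof.
move=> c_inj stepu stepv eq_c.
(* After a first move, the walk has already visited one of the neighbours of
   its present place: its copy there fixes the orientation for the next move. *)
pose moved k := exists2 i, i <= k & (u i == (u k).+1) || (u k == (u i).+1).
suff: forall k, k <= n ->
    (forall i, i <= k -> u i = u 0 /\ v i = v 0) \/
    (moved k /\ ((forall i, i <= k -> v i + u 0 = v 0 + u i) \/
      (forall i, i <= k -> v i + u i = v 0 + u 0))).
  move=> /(_ n (leqnn n)) [const|[] //].
  by left=> i /const [-> ->].
elim=> [|k IHk] lt_kn; first by left=> i; rewrite leqn0 => /eqP->.
have := stepu k lt_kn; have := stepv k lt_kn; rewrite /near => nv nu.
have eqk := eq_c k (ltnW lt_kn); have eqk1 := eq_c k.+1 lt_kn.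
have stay : u k.+1 = u k -> v k.+1 = v k.
  by move=> eq_u; apply: c_inj; try lia; congruence.
have stay' : v k.+1 = v k -> u k.+1 = u k.
  by move=> eq_v; apply: c_inj; try lia; congruence.
have leS i : i <= k.+1 -> i <= k \/ i = k.+1 by lia.
case: (IHk (ltnW lt_kn)) => [const|[[j le_jk adj] iso]].
  have [uk vk] := const k (leqnn k).
  have [eq_u|neq_u] := eqVneq (u k.+1) (u k).
    left=> i /leS [/const //|->]; rewrite eq_u stay //.
  right; split; first by exists k => //; lia.
  have neq_v : v k.+1 <> v k by move/stay'/eqP; apply/negP.
  have [h|h] := eqVneq (v k.+1 + u 0) (v 0 + u k.+1); [left|right].
    by move=> i /leS [/const[-> ->]|->].
  by move=> i /leS [/const[-> ->]|->] //; lia.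
right; split.
  have [eq_u|neq_u] := eqVneq (u k.+1) (u k).
    by exists j; [lia | rewrite eq_u].
  by exists k => //; lia.
have eqj : c (u j) = c (v j) by apply: eq_c; lia.
(* The step taken is towards u j exactly when its copy is towards v j. *)
have same : u k.+1 = u j -> v k.+1 = v j.
  move=> eq_u; apply: c_inj; last by congruence.
    by case: iso => iso; have := iso j le_jk; have := iso k (leqnn k); lia.
  by case: iso => iso; have := iso j le_jk; have := iso k (leqnn k); lia.
have same' : v k.+1 = v j -> u k.+1 = u j.
  by move=> eq_v; apply: c_inj; last congruence; lia.
case: iso => iso; [left|right] => i /leS [/iso //|->];
  have := iso j le_jk; have := iso k (leqnn k); lia.
Qed.

(** By [equicoloured_walks], the second half of the walk is a translate or a
    reflection of the first.  In a translate by a nonzero amount, the first half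
    goes from its start to a place adjacent to the start of its translate, so
    it covers a whole period and the word has a square.  In a reflection,
    the first half reaches the middle of the reflection: either a fixed place,
    or one of two adjacent places exchanged by it, which would have the same
    letter. *)
Lemma repetitive_lazy_walk (c w : nat -> nat) t :
  squarefree c -> window_injective c ->
  0 < t -> (forall i, i.+1 < t + t -> near (w i) (w i.+1)) ->
  (forall i, i < t -> c (w i) = c (w (t + i))) ->
  exists2 i, i < t & w i = w (t + i).
Proof.
case: t => // n c_sqf c_inj _ step rep.
have ivt := @lazy_walk_ivt w n.
have {}ivt m : (w 0 <= m <= w n) || (w n <= m <= w 0) -> exists2 i, i <= n & w i = m.
  by apply: ivt => i lt_in; apply: step; lia.
have turn : near (w n) (w n.+1) by apply: step; lia.
have hit i : i <= n -> w i = w (n.+1 + i) -> exists2 i, i < n.+1 & w i = w (n.+1 + i).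
  by move=> le_in eq_w; exists i.
move: turn; rewrite /near => turn.
have [] := @equicoloured_walks c w (fun i => w (n.+1 + i)) n c_inj.
- by move=> i lt_in; apply: step; lia.
- by move=> i lt_in; rewrite addnS; apply: step; lia.
- by move=> i le_in; apply: rep; lia.
- rewrite addn0 => trans; case: (ltngtP (w 0) (w n.+1)) => cmp.
  + exfalso; apply: (c_sqf (w 0) (w n.+1 - w 0)) => [|j lt_j]; first by lia.
    have [|i le_in eq_i] := ivt (w 0 + j); first by lia.
    by rewrite -eq_i rep ?ltnS //; congr c; have := trans i le_in; lia.
  + (* Downwards, the square starts at the translate of the lowest of the places
       that make up the period, [w n.+1 + 1]. *)
    exfalso; have room : w 0 <= w n.+1 + w n.+1 + 1.
      have [|i le_in eq_i] := ivt (w n.+1 + 1); first by lia.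
      by have := trans i le_in; lia.
    apply: (c_sqf (w n.+1 + w n.+1 + 1 - w 0) (w 0 - w n.+1)) => [|j lt_j]; first by lia.
    have [|i le_in eq_i] := ivt (w n.+1 + 1 + j); first by lia.
    have -> : w n.+1 + w n.+1 + 1 - w 0 + (w 0 - w n.+1) + j = w i by lia.
    by rewrite rep ?ltnS //; congr c; have := trans i le_in; lia.
  + by apply: (hit 0) => //; rewrite addn0.
rewrite addn0 => refl.
case: (leqP (w 0) (w n.+1)) => cmp.
  have [le0|gt0] := leqP (w n.+1) (w 0).
    by apply: (hit 0) => //; rewrite addn0; lia.
  have [|i le_in eq_i] := ivt (w n.+1 + w 0)./2; first by lia.
  by have hr := refl i le_in; apply: (hit i le_in); apply: c_inj; [lia | lia | exact: rep].
have [|i le_in eq_i] := ivt (uphalf (w n.+1 + w 0)); first by lia.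
by have hr := refl i le_in; apply: (hit i le_in); apply: c_inj; [lia | lia | exact: rep].
Qed.

(** * Repetitively coloured sequences *)

(** Transitivity is required only through the elements that are removed: the
    intersection of intervals, for instance, is transitive only through the
    intervals reduced to a point. *)
Lemma sorted_filter_through (T : Type) (a : pred T) (r : rel T) (s : seq T) :
  (forall x y z, ~~ a y -> r x y -> r y z -> r x z) ->
  sorted r s -> sorted r (filter a s).
Proof.
move=> r_through.
have path_filter x t : path r x t -> path r x (filter a t).
  elim: t x => //= y t IHt x /andP[rxy path_t].
  case: ifP => [_|/negbT not_ay]; first by rewrite /= rxy IHt.
  case: t IHt path_t => //= z t IHt /andP[ryz path_t].
  by apply: IHt => /=; rewrite (r_through _ _ _ not_ay rxy ryz).
elim: s => //= x s IHs path_s.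
case: ifP => [_|_]; first exact: path_filter.
exact/IHs/(path_sorted path_s).
Qed.

Lemma repetitively_coloured_square (G : sgraph) (C : Type) (psi : G -> C) s :
  repetitively_coloured psi s -> exists2 y, y <> [::] & map psi s = y ++ y.
Proof.
case: s => [|v s] [t [t_gt0 size_s eq_col]]; first by move: size_s => /=; lia.
set c := map psi (v :: s) in eq_col *.
have size_c : size c = t + t by rewrite size_map.
exists (take t c) => [/(congr1 size)|].
  by rewrite size_takel ?size_c /=; lia.
rewrite -{1}(cat_take_drop t c); congr (_ ++ _).
apply: (@eq_from_nth _ (psi v)) => [|i].
  by rewrite size_drop size_takel ?size_c; lia.
rewrite size_drop size_c => lt_it; have {}lt_it : i < t by lia.
by rewrite nth_drop nth_take // -!odflt_onth (eq_col i).
Qed.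

(** * Layers of an interval representation *)

Definition bag (T : finType) (l r : T -> nat) (A : {set T}) (y : nat) : {set T} :=
  [set v in A | l v <= y <= r v].

(** The last selected point up to [n]; the point [n] itself is selected when
    [separator b n = n]. *)
Fixpoint separator (T : finType) (b : nat -> {set T}) (n : nat) : nat :=
  if n is m.+1 then
    if [disjoint b n & b (separator b m)] then n else separator b m
  else 0.

Lemma separator_le (T : finType) (b : nat -> {set T}) n : separator b n <= n.
Proof. by elim: n => //= n IHn; case: ifP => // _; apply: ltnW. Qed.

Lemma separator_id (T : finType) (b : nat -> {set T}) n :
  separator b (separator b n) = separator b n.
Proof. by elim: n => //= n IHn; case: ifP => //= ->. Qed.

Lemma separator_mono (T : finType) (b : nat -> {set T}) m n :
  m <= n -> separator b m <= separator b n.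
Proof.
elim: n => [|n IHn]; first by rewrite leqn0 => /eqP->.
rewrite leq_eqVlt => /predU1P[->//|/IHn le_sep] /=.
by case: ifP => // _; apply: leq_trans le_sep _; apply: leqW; apply: separator_le.
Qed.

Definition separators_before (T : finType) (b : nat -> {set T}) (n : nat) : nat :=
  \sum_(i < n) (separator b i == i).

Lemma separators_beforeS (T : finType) (b : nat -> {set T}) n :
  separators_before b n.+1 = separators_before b n + (separator b n == n).
Proof. exact: big_ord_recr. Qed.

Lemma separators_before_mono (T : finType) (b : nat -> {set T}) m n :
  m <= n -> separators_before b m <= separators_before b n.
Proof.
move=> /subnKC <-; elim: (n - m) => [|d IHd]; first by rewrite addn0.
by rewrite addnS separators_beforeS (leq_trans IHd) // leq_addr.
Qed.

Lemma separators_before_lt (T : finType) (b : nat -> {set T}) m x n :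
  separator b x = x -> m <= x < n -> separators_before b m < separators_before b n.
Proof.
move=> sep_x /andP[le_mx lt_xn].
apply: leq_trans (separators_before_mono b lt_xn).
by rewrite separators_beforeS sep_x eqxx addn1 ltnS separators_before_mono.
Qed.

Lemma first_separator (T : finType) (b : nat -> {set T}) m n :
  separators_before b m < separators_before b n ->
  exists x, [/\ separator b x = x, m <= x < n &
    separators_before b x = separators_before b m].
Proof.
elim: n => [|n IHn]; first by rewrite ltnNge separators_before_mono.
have [lt_mn _|le_nm] := ltnP (separators_before b m) (separators_before b n).
  by have [x [? ? ?]] := IHn lt_mn; exists x; split=> //; lia.
move=> lt_mn; have le_mn : m <= n.
  by rewrite -ltnS ltnNge; apply: contraL lt_mn => ?; rewrite -leqNgt separators_before_mono.
have := separators_before_mono b le_mn.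
move: lt_mn; rewrite separators_beforeS; case: eqP => [sep_n _ ?|_]; last by lia.
by exists n; split=> //; lia.
Qed.

(** The witnesses [p v] and [q v] count the selected points before and up to the
    end of the interval of [v].  They differ by at most 1 because the selected
    bags are disjoint.  When [q v = (p v).+1], the vertex [v] is in layer number
    [p v]; when [p v = q v], its interval contains no selected point.  The
    intervals of adjacent vertices still intersect once [[l v, r v]] is replaced
    by [[p v, q v]], and the latter has length 1 for the vertices in layers and
    0 for the others. *)
Lemma separating_layers (T : finType) (l r : T -> nat) (A : {set T}) k :
  (forall v, l v <= r v) -> (forall y, #|bag l r A y| <= k) ->
  exists p q : T -> nat,
    [/\ forall v, v \in A -> p v <= q v <= (p v).+1,
        forall u v, l u <= r v -> p u <= q v,
        forall i, #|[set v in A | (p v == i) && (q v == i.+1)]| <= k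
      & forall y, #|bag l r [set v in A | p v == q v] y| <= k.-1].
Proof.
move=> le_lr bag_k; pose b := bag l r A; pose N := separators_before b.
have in_b v x : (v \in b x) = (v \in A) && (l v <= x <= r v) by rewrite inE.
exists (N \o l), (N \o succn \o r); split=> /= [v vA|u v le_uv|i|y].
- have le_l_r1 : l v <= (r v).+1 by apply: leqW.
  rewrite separators_before_mono //= leqNgt; apply/negP => lt2.
  have [|x [sep_x lx eq_x]] := @first_separator _ b (l v) (r v).+1.
    exact: ltn_trans lt2.
  have Nx1 : N x.+1 = (N (l v)).+1.
    by rewrite /N separators_beforeS sep_x eqxx addn1 eq_x.
  have [|y [sep_y ly _]] := @first_separator _ b x.+1 (r v).+1; first by rewrite -/N Nx1.
  case: y sep_y ly => [|y] sep_y ly; first by lia.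
  have le_xs : x <= separator b y by rewrite -{1}sep_x separator_mono //; lia.
  move: sep_y => /=; case: ifP => [dis _|_ sep_y]; last first.
    by have := separator_le b y; lia.
  have v_y : v \in b y.+1 by rewrite in_b vA; lia.
  have := disjointFr dis v_y; rewrite in_b vA /=.
  by have := separator_le b y; lia.
- by apply: separators_before_mono; lia.
- case: (set_0Vmem [set v in A | (N (l v) == i) && (N (r v).+1 == i.+1)]) => [->|[v]].
    by rewrite cards0.
  have sel u : u \in [set v in A | (N (l v) == i) && (N (r v).+1 == i.+1)] ->
      exists x, [/\ separator b x = x, u \in b x & N x = i].
    rewrite inE => /and3P[uA /eqP pu /eqP qu].
    have [|x [sep_x lx Nx]] := @first_separator _ b (l u) (r u).+1.
      by rewrite -/N pu qu.
    by exists x; rewrite in_b uA -pu; split.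
  move=> /sel [x [sep_x _ Nx]]; apply: leq_trans (bag_k x).
  apply/subset_leq_card/subsetP => u /sel [x' [sep_x' u_x' Nx']].
  suff <- : x' = x by [].
  case: (ltngtP x' x) => // lt.
    by have := @separators_before_lt _ b x' x' x sep_x'; rewrite -/N Nx Nx'; lia.
  by have := @separators_before_lt _ b x x x' sep_x; rewrite -/N Nx Nx'; lia.
have [b0|[z0 z0b]] := set_0Vmem (b y).
  suff -> : bag l r [set v in A | N (l v) == N (r v).+1] y = set0 by rewrite cards0.
  apply/setP => v; have /setP/(_ v) := b0; rewrite !inE.
  by case: (v \in A); case: (l v <= y <= r v); rewrite ?andbF.
(* The nonempty bag of [y] meets the selected bag at or before [y], and a common
   vertex [z] belongs to a layer. *)
have [z zb lt_z] : exists2 z, z \in b y & N (l z) < N (r z).+1.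
  have [z zb zs] : exists2 z, z \in b y & z \in b (separator b y).
    have [sep_y|] := eqVneq (separator b y) y; first by exists z0; rewrite ?sep_y.
    case: (y) => //= m; case: ifP => [_|]; first by rewrite eqxx.
    by move/negbT/pred0Pn => [z /andP[? ?]] _; exists z.
  exists z => //; apply: (@separators_before_lt _ b _ (separator b y)).
    exact: separator_id.
  by move: zs; rewrite in_b => /andP[_]; rewrite ltnS.
apply: leq_trans (_ : #|b y :\ z| <= _).
  apply/subset_leq_card/subsetP => v; rewrite !inE => /andP[/andP[vA eq_v] ->].
  rewrite vA !andbT; apply: contraTneq eq_v => ->.
  by rewrite neq_ltn lt_z.
have := bag_k y; rewrite -/(b y) (cardsD1 z) zb; lia.
Qed.

(** * Colouring by induction on the size of the bags *)

Lemma interval_colouring (G : sgraph) (l r : G -> nat) :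
  (forall v, l v <= r v) -> (forall u v, edge u v -> l u <= r v) ->
  forall k (A : {set G}), (forall y, #|bag l r A y| <= k.+1) ->
  exists psi : G -> nat,
    (forall v, v \in A -> psi v < 2 * k ^ 2 + 6 * k + 1) /\
    (forall s y, is_path s -> all (mem A) s -> y <> [::] -> map psi s <> y ++ y).
Proof.
move=> le_lr edge_lr; elim=> [|k IHk] A bagA.
  exists (fun=> 0); split=> // -[|u [|v s]] [|c y] //= pathp sA _.
    by case: y => [|? ?] [].
  move=> _; move: pathp sA => /andP[/= /andP[]].
  rewrite inE negb_or => /andP[neq_uv _] _ /andP[uv _] /and3P[uA vA _].
  have vu : edge v u by rewrite edge_sym.
  have := bagA (maxn (l u) (l v)); rewrite leqNgt => /negP; apply.
  suff: [set u; v] \subset bag l r A (maxn (l u) (l v)).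
    by move/subset_leq_card; rewrite cards2 neq_uv.
  apply/subsetP => x; rewrite !inE; have := edge_lr _ _ uv; have := edge_lr _ _ vu.
  have := le_lr u; have := le_lr v.
  by move=> ? ? ? ? /orP[]/eqP->; [rewrite uA | rewrite vA]; lia.
have [p [q [pq pq_edge layer_k inner_k]]] := separating_layers le_lr bagA.
have [psi' [psi'_lt psi'_sqf]] := IHk _ inner_k.
pose layer i := [set v in A | (p v == i) && (q v == i.+1)].
pose label v := index v (enum (layer (p v))).
(* The first K colours are for the layers, the others for the induction. *)
pose K := 4 * k.+2.
pose psi v := if p v == q v then K + psi' v
  else 4 * label v + quaternary_word (p v).
have layerP v : v \in A -> p v != q v -> v \in enum (layer (p v)).
  by move=> vA neq; rewrite mem_enum inE vA eqxx /=; have := pq v vA; lia.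
have label_lt v : v \in A -> p v != q v -> label v < k.+2.
  move=> vA neq; apply: leq_trans (layer_k (p v)).
  by rewrite cardE index_mem layerP.
have psiK v : v \in A -> (psi v < K) = (p v != q v).
  move=> vA; rewrite /psi /K; case: eqP => [_|/eqP neq /=]; first by lia.
  by have := label_lt v vA neq; have := quaternary_word_lt4 (p v); lia.
exists psi; split=> [v vA|s y /andP[uniq_s path_s] sA y_n0 rep].
  have [eq|neq] := eqVneq (p v) (q v); last by have := psiK v vA; rewrite neq /K; lia.
  have := psi'_lt v; rewrite inE vA eq eqxx => /(_ isT).
  by rewrite /psi eq eqxx /K; lia.
pose s' := [seq v <- s | p v != q v]; pose y' := [seq c <- y | c < K].
have rep' : map psi s' = y' ++ y'.
  rewrite -filter_cat -rep filter_map; congr map.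
  by apply: eq_in_filter => v /(allP sA) /psiK /= ->.
have s'A v : v \in s' -> v \in A /\ p v != q v.
  by rewrite mem_filter => /andP[? /(allP sA)].
have [y'0|y'n0] := eqVneq y' [::].
  have s'0 : s' = [::] by apply/nilP; rewrite /nilp -(size_map psi) rep' y'0.
  have inner v : v \in s -> p v == q v.
    move=> v_s; apply: contraT => neq.
    by have : v \in s' by [rewrite mem_filter neq]; rewrite s'0.
  apply: (psi'_sqf s (map (subn^~ K) y)); first by rewrite /is_path uniq_s.
  - by apply/allP => v v_s; rewrite inE /= inE inner // andbT; apply: (allP sA).
  - by case: (y) y_n0.
  rewrite -map_cat -rep -map_comp; apply/eq_in_map => v /inner eq_pq.
  by rewrite /= /psi eq_pq addKn.
have size_s' : size s' = size y' + size y'.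
  by rewrite -(size_map psi) rep' size_cat.
have y'_gt0 : 0 < size y' by rewrite lt0n size_eq0.
have [x0 _] : exists x0 : G, true.
  by case: (s') size_s' => [|x0 ?] => [/=|_]; [lia | exists x0].
(* Two intervals that meet a third one reduced to a point have this point in
   common: dropping the vertices outside the layers preserves intersection. *)
have near_s' : sorted (fun u v => (p u <= q v) && (p v <= q u)) s'.
  apply: sorted_filter_through => [u v w|].
    by rewrite negbK => /eqP eq /andP[? ?] /andP[? ?]; lia.
  apply: sub_sorted path_s => u v uv.
  by rewrite !pq_edge // edge_lr // edge_sym.
have nthA i : i < size s' -> nth x0 s' i \in A /\ p (nth x0 s' i) != q (nth x0 s' i).
  by move=> lt_i; apply: s'A; apply: mem_nth.
have psi_nth i : i < size y' -> psi (nth x0 s' i) = psi (nth x0 s' (size y' + i)).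
  move=> lt_i; rewrite -!(nth_map x0 (psi x0)) ?size_s'; [|lia|lia].
  by rewrite rep' !nth_cat lt_i ltnNge leq_addr /= addKn.
have psi_s' i : i < size s' -> psi (nth x0 s' i) =
    4 * label (nth x0 s' i) + quaternary_word (p (nth x0 s' i)).
  by move=> /nthA [_ /negbTE neq]; rewrite /psi neq.
have [|i lt_i|i lt_i eq_p] := @repetitive_lazy_walk quaternary_word
  (fun i => p (nth x0 s' i)) _ quaternary_word_squarefree quaternary_word_window y'_gt0.
- move=> i; rewrite -size_s' => lt_i.
  have := sortedP x0 near_s' i lt_i.
  have [/pq ? ?] := nthA i (ltnW lt_i); have [/pq ? ?] := nthA i.+1 lt_i.
  by rewrite /near; lia.
- have := psi_nth i lt_i; rewrite !psi_s'; [|lia|lia].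
  have := quaternary_word_lt4 (p (nth x0 s' i)).
  by have := quaternary_word_lt4 (p (nth x0 s' (size y' + i))); lia.
have lt1 : i < size s' by lia.
have lt2 : size y' + i < size s' by lia.
have eq_label : label (nth x0 s' i) = label (nth x0 s' (size y' + i)).
  by have := psi_nth i lt_i; rewrite !psi_s' // eq_p; lia.
have [A1 X1] := nthA _ lt1; have [A2 X2] := nthA _ lt2.
have := layerP _ A2 X2; move: eq_label; rewrite /label -eq_p => eq_label in_layer2.
have := congr1 (nth x0 (enum (layer (p (nth x0 s' i))))) eq_label.
rewrite !nth_index ?layerP // => /eqP.
by rewrite nth_uniq ?filter_uniq //; lia.
Qed.

Lemma path_decomposition_interval (G : sgraph) (B : seq {set G}) :
  is_path_decomposition B ->
  exists l r : G -> nat, forall v x, (v \in nth set0 B x) = (l v <= x <= r v).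
Proof.
move=> [_ covered consecutive].
suff /fin_all_exists [lr lrP] : forall v : G, exists lr : nat * nat,
    forall x, (v \in nth set0 B x) = (lr.1 <= x <= lr.2).
  by exists (fun v => (lr v).1), (fun v => (lr v).2).
move=> v; have in_size x : v \in nth set0 B x -> x < size B.
  by rewrite ltnNge; apply: contraL => le; rewrite nth_default // inE.
have ex_v : exists x, v \in nth set0 B x by have [x _ ?] := covered v; exists x.
have bounded x : v \in nth set0 B x -> x <= size B by move/in_size/ltnW.
exists (ex_minn ex_v, ex_maxn ex_v bounded) => x /=.
case: ex_minnP => m v_m min_m; case: ex_maxnP => M v_M max_M.
apply/idP/idP => [v_x|le_x]; first by rewrite min_m ?max_M.
exact: consecutive le_x (in_size _ v_M) v_m v_M.
Qed.

Theorem theorem3 (G : sgraph) (theta : nat) (Htheta : pathwidth G = theta) :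
  nonrepetitive_chromatic_number G <= 2 * theta ^ 2 + 6 * theta + 1.
Proof.
have [B decB widthB] : has_path_decomposition_of_width G theta.
  by move: Htheta; rewrite /pathwidth; case: ex_minnP => m /asboolP + _ <-.
rewrite /nonrepetitive_chromatic_number; case: ex_minnP => m _; apply.
have [l [r lrP]] := path_decomposition_interval decB.
have [edge_bag covered _] := decB.
have le_lr v : l v <= r v.
  by have [x _] := covered v; rewrite lrP => /andP[/leq_trans]; apply.
have edge_lr u v : edge u v -> l u <= r v.
  move=> /edge_bag [b /(nthP set0)[x _ <-]]; rewrite !lrP.
  by move=> /andP[/andP[lx _] /andP[_ xr]]; apply: leq_trans xr.
have bag_theta y : #|bag l r [set: G] y| <= theta.+1.
  have [lt_y|le_y] := ltnP y (size B); last first.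
    apply: leq_trans (_ : #|@set0 G| <= _); last by rewrite cards0.
    apply/subset_leq_card/subsetP => v; rewrite !inE /= -lrP nth_default //.
    by rewrite inE.
  apply: leq_trans (_ : #|nth set0 B y| <= _).
    by apply/subset_leq_card/subsetP => v; rewrite !inE /= -lrP.
  rewrite -widthB /width; apply: leq_trans (leqSpred _).
  exact: (leq_bigmax_seq (nth set0 B y) (mem_nth set0 lt_y)).
have [psi [psi_lt psi_sqf]] := interval_colouring le_lr edge_lr bag_theta.
apply/asboolP; exists (fun v => Ordinal (psi_lt v (in_setT v))).
move=> s path_s /repetitively_coloured_square [y y_n0 rep].
apply: (psi_sqf s (map val y) path_s); first by apply/allP => v; rewrite inE.
  by case: (y) y_n0.
by rewrite -map_cat -rep -map_comp.
Qed.
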